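(* Let $\mu$ be a probability measure on $\mathbb{C}$ with compact support, and let $X_1, X_2, \ldots$ be iid random variables with distribution $\mu$. For each $n\ge1$ let $\xi_1^{(n)}, \ldots, \xi_{k_n}^{(n)}$ be deterministic complex numbers, where $k_n \le K$ for some constant $K$ independent of $n$ (no bound on the magnitudes $|\xi_l^{(n)}|$ is assumed). Fix $\varepsilon > 0$ and suppose that for all sufficiently large $n$: none of $\xi_1^{(n)}, \ldots, \xi_{k_n}^{(n)}$ lies in $N_\mu(3\varepsilon)\setminus N_\mu(\varepsilon)$, the value $\xi_1^{(n)}$ lies outside $N_\mu(3\varepsilon)$, and $\xi_2^{(n)},\ldots,\xi_{k_n}^{(n)}$ lie in $N_\mu(\varepsilon)$. Then there is a constant $C>0$ such that, almost surely, for all sufficiently large $n$, the polynomial \[ p_n(z) := \prod_{j=1}^{n-k_n} (z - X_j) \prod_{l=1}^{k_n} (z - \xi_l^{(n)}) \] has exactly one critical point $w_1(p_n)$ outside $N_\mu(2\varepsilon)$, and it satisfies \[ |w_1(p_n) - \xi_1^{(n)}| \le \frac{C}{n}\left(1 + |\xi_1^{(n)}|\right), \] i.e. $w_1(p_n) = \xi_1^{(n)}(1 + O(1/n)) + O(1/n)$.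
   Context: For a probability measure $\mu$ on $\mathbb{C}$, $m_\mu(z) := \int_{\mathbb{C}} \frac{d\mu(x)}{z-x}$ for $z \notin \operatorname{supp}(\mu)$; $M_\mu := \{ z \in \mathbb{C}\setminus \operatorname{supp}(\mu) : m_\mu(z) = 0\}$; and $N_\mu(\varepsilon) := \{ z \in \mathbb{C} : \operatorname{dist}(z, \operatorname{supp}(\mu) \cup M_\mu) < \varepsilon\}$. A critical point of a polynomial is a zero of its derivative. *)

(* Defs.v *)
From HB Require Import structures.
From mathcomp Require Import all_boot all_order all_algebra.
From mathcomp Require Import all_classical all_reals all_analysis.
From mathcomp Require Import complex.
Set Implicit Arguments.
Unset Strict Implicit.
Unset Printing Implicit Defensive.
Import Order.TTheory GRing.Theory Num.Theory.
Local Open Scope ring_scope.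
Local Open Scope classical_set_scope.
Local Open Scope complex_scope.

(* The complex plane C is modelled as the measurable space R * R (product
   Borel sigma-algebra = Borel sigma-algebra of C); [cplx] identifies a
   point of R * R with the complex number x.1 + i x.2 in R[i]. *)
Definition cplx {R : realType} (x : R * R) : R[i] := Complex x.1 x.2.

Section MuDefs.
Context {R : realType} (mu : probability (R * R)%type R).

Definition supp : set R[i] :=
  [set z | forall r : R, 0 < r ->
     (0 < mu [set x | (`|cplx x - z| < r%:C)%R])%E].

Definition m_mu (z : R[i]) : R[i] :=
  Complex (Rintegral mu setT (fun x => complex.Re ((z - cplx x)^-1)))
          (Rintegral mu setT (fun x => complex.Im ((z - cplx x)^-1))).

Definition M_mu : set R[i] := [set z | ~ supp z /\ m_mu z = 0].

Definition N_mu (eps : R) : set R[i] :=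
  [set z | exists2 w, (supp `|` M_mu) w & `|z - w| < eps%:C].

End MuDefs.

Definition mutually_independent {R : realType} {d : measure_display}
  {T : measurableType d} (P : probability T R) (X : nat -> T -> (R * R)%type) :=
  forall (J : seq nat) (A : nat -> set (R * R)%type),
    uniq J -> (forall j, j \in J -> measurable (A j)) ->
    P [set w | forall j, j \in J -> A j (X j w)] =
    (\prod_(j <- J) P (X j @^-1` A j))%E.

(* p_n(z) = prod_{j=1}^{n-k_n} (z - X_j) prod_{l=1}^{k_n} (z - xi_l);
   X_1, X_2, ... are indexed here from 0. *)
Definition p_poly {R : realType} (n : nat) (Xs : nat -> R[i]) (xis : seq R[i])
  : {poly R[i]} :=
  (\prod_(j < n - size xis) ('X - (Xs j)%:P)) * \prod_(x <- xis) ('X - x%:P).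

(* Main.v *)
Require Import Defs.
From HB Require Import structures.
From mathcomp Require Import all_boot all_order all_algebra.
From mathcomp Require Import all_classical all_reals all_analysis.
From mathcomp Require Import complex measurable_realfun ring lra zify.
Import Order.TTheory GRing.Theory Num.Theory.
Local Open Scope ring_scope.
Local Open Scope classical_set_scope.
Local Open Scope complex_scope.
Import numFieldNormedType.Exports.
Import ComplexField.Normc.

(** Write p = (X - xi_1) q and L = q'/q, the sum of 1/(z - x) over the other
    roots x.  Off the roots of q, the critical points of p are the fixed points of
    T z = xi_1 - 1/L(z).  Outside N_mu(2 eps) one has almost surely, for large n,
    |L(z)| >= c n / (1 + |z|): for large |z| this is elementary, and on a compact
    set it follows from the strong law of large numbers at finitely many points,
    since the averages of 1/(z - X_j) are equi-Lipschitz there and m_mu does not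
    vanish.  As |z - x| >= b (1 + |z|) for every root x of q, T is Lipschitz with
    constant 1/(b^2 c^2 n), and it maps the disc of radius 2(1 + |xi_1|)/(c n)
    around xi_1 to itself; this disc contains every critical point outside
    N_mu(2 eps), so Banach's theorem gives existence and uniqueness. *)

(** * The modulus of a complex number as a real number *)

Section Modulus.
Context {R : realType}.
Implicit Types w z : R[i].

Lemma normrC_normc w : `|w| = (normc w)%:C. Proof. by []. Qed.

Lemma normc_ge0 w : 0 <= normc w.
Proof. by case: w => a b; exact: sqrtr_ge0. Qed.

Lemma normcD w z : normc (w + z) <= normc w + normc z.
Proof. by rewrite -lecR rmorphD /= -!normrC_normc ler_normD. Qed.

Lemma normcN w : normc (- w) = normc w.
Proof. by apply: complexI; rewrite -!normrC_normc normrN. Qed.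

Lemma normcB w z : normc (w - z) = normc (z - w).
Proof. by rewrite -normcN opprB. Qed.

Lemma normc_dist (a b c : R[i]) : normc (a - c) <= normc (a - b) + normc (b - c).
Proof. by have := normcD (a - b) (b - c); rewrite addrA subrK. Qed.

Lemma normc_gt0 w : w != 0 -> 0 < normc w.
Proof.
move=> w0; rewrite lt_def normc_ge0 andbT.
by apply: contra w0 => /eqP /eq0_normc ->.
Qed.

Lemma normc_sum (I : Type) (s : seq I) (F : I -> R[i]) :
  normc (\sum_(i <- s) F i) <= \sum_(i <- s) normc (F i).
Proof.
elim: s => [|i s IH]; first by rewrite !big_nil normc0.
by rewrite !big_cons (le_trans (normcD _ _)) // lerD2l.
Qed.

Lemma normc_real (a : R) : normc a%:C = `|a|.
Proof. by rewrite /= expr0n addr0 sqrtr_sqr. Qed.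

Lemma normc_Re w : `|complex.Re w| <= normc w.
Proof.
case: w => a b /=; rewrite -sqrtr_sqr ler_sqrt ?lerDl ?sqr_ge0 //.
by rewrite addr_ge0 ?sqr_ge0.
Qed.

Lemma normc_Im w : `|complex.Im w| <= normc w.
Proof.
case: w => a b /=; rewrite -sqrtr_sqr ler_sqrt ?lerDr ?sqr_ge0 //.
by rewrite addr_ge0 ?sqr_ge0.
Qed.

Lemma normc_ReIm w : normc w <= `|complex.Re w| + `|complex.Im w|.
Proof.
rewrite {1}[w]complexE (le_trans (normcD _ _)) // normcM !normc_real.
by rewrite (_ : normc 'i = 1) ?mul1r //= expr0n expr1n add0r sqrtr1.
Qed.

End Modulus.

(** * Limits of geometrically convergent sequences and the contraction principle *)

Section GeometricLimit.
Context {R : realType}.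

(** The radius [h k] is the tail of the geometric series of the steps, so the intervals
    [u k - h k, u k + h k] are nested; the limit is the supremum of their left endpoints. *)
Lemma real_geometric_limit (u : nat -> R) (a : R) :
  (forall k, `|u k.+1 - u k| <= a / 2 ^+ k) ->
  exists l, forall k, `|l - u k| <= 2 * a / 2 ^+ k.
Proof.
move=> ua.
pose h k := 2 * a / 2 ^+ k.
have hS k : h k.+1 = h k - a / 2 ^+ k.
  by rewrite /h exprS; field; rewrite expf_eq0 pnatr_eq0 andbF.
have a0 k : 0 <= a / 2 ^+ k by exact: le_trans (ua k).
have h0 k : 0 <= h k by rewrite /h -mulrA mulr_ge0.
have up m k : u k - h k <= u (k + m)%N - h (k + m)%N.
  elim: m => [|m IH]; first by rewrite addn0.
  apply: (le_trans IH); rewrite addnS hS.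
  by have := ua (k + m)%N; rewrite ler_norml => /andP[]; lra.
have dn m k : u (k + m)%N + h (k + m)%N <= u k + h k.
  elim: m => [|m IH]; first by rewrite addn0.
  apply: le_trans IH; rewrite addnS hS.
  by have := ua (k + m)%N; rewrite ler_norml => /andP[]; lra.
have lu i j : u i - h i <= u j + h j.
  have [ij|/ltnW ji] := leqP i j.
    by have := up (j - i)%N i; rewrite subnKC //; have := h0 j; lra.
  by have := dn (i - j)%N j; rewrite subnKC //; have := h0 i; lra.
pose E := range (fun k => u k - h k).
have supE : has_sup E.
  split; first by exists (u 0%N - h 0%N), 0%N.
  by exists (u 0%N + h 0%N) => _ [k _ <-].
exists (sup E) => k; rewrite ler_norml; apply/andP; split.
  have : u k - h k <= sup E by apply: sup_upper_bound => //; exists k.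
  by rewrite /h; lra.
have : sup E <= u k + h k.
  by apply: ge_sup; [case: supE|move=> _ [j _ <-]; exact: lu].
by rewrite /h; lra.
Qed.

Lemma complex_geometric_limit (u : nat -> R[i]) (a : R) :
  (forall k, normc (u k.+1 - u k) <= a / 2 ^+ k) ->
  exists l, forall k, normc (l - u k) <= 4 * a / 2 ^+ k.
Proof.
move=> ua.
have [x xP] : exists x, forall k, `|x - complex.Re (u k)| <= 2 * a / 2 ^+ k.
  apply: real_geometric_limit => k; apply: le_trans (ua k).
  by rewrite (le_trans _ (normc_Re _)) //; case: (u k.+1); case: (u k).
have [y yP] : exists y, forall k, `|y - complex.Im (u k)| <= 2 * a / 2 ^+ k.
  apply: real_geometric_limit => k; apply: le_trans (ua k).
  by rewrite (le_trans _ (normc_Im _)) //; case: (u k.+1); case: (u k).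
exists (Complex x y) => k; apply: le_trans (normc_ReIm _) _.
rewrite (_ : complex.Re _ = x - complex.Re (u k)); last by case: (u k).
rewrite (_ : complex.Im _ = y - complex.Im (u k)); last by case: (u k).
by apply: le_trans (lerD (xP k) (yP k)) _; lra.
Qed.

Lemma geometric_small (a e : R) : 0 < e -> exists k, a / 2 ^+ k < e.
Proof.
move=> e0; exists (Num.truncn (`|a| / e)).+1.
rewrite ltr_pdivrMr ?exprn_gt0 // (le_lt_trans (ler_norm _)) //.
rewrite mulrC -ltr_pdivrMr //.
apply: (lt_trans (truncnS_gt _)).
by rewrite -natrX ltr_nat ltn_expl.
Qed.

(** Banach iteration started at the centre: the first step has length at most r and each later one
    at most half its predecessor, so the iterates converge geometrically. *)
Lemma complex_contraction (T : R[i] -> R[i]) (c : R[i]) (r : R) :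
  0 <= r ->
  (forall z, normc (z - c) <= r -> normc (T z - c) <= r) ->
  (forall z w, normc (z - c) <= r -> normc (w - c) <= r ->
     normc (T z - T w) <= normc (z - w) / 2) ->
  exists2 z, normc (z - c) <= r & T z = z.
Proof.
move=> r0 Tball Tlip.
pose u k := iter k T c.
have uball k : normc (u k - c) <= r.
  by elim: k => [|k IH] /=; [rewrite /u /= subrr normc0|exact: Tball].
have ustep k : normc (u k.+1 - u k) <= r / 2 ^+ k.
  elim: k => [|k IH].
    by rewrite expr0 divr1; apply: Tball; rewrite /= subrr normc0.
  rewrite (le_trans (Tlip _ _ (uball k.+1) (uball k))) //.
  rewrite exprSr invfM mulrA; lra.
have [l lP] := complex_geometric_limit _ _ ustep.
have lball : normc (l - c) <= r.
  rewrite leNgt; apply/negP => rl.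
  have e0 : 0 < normc (l - c) - r by rewrite subr_gt0.
  have [k] := geometric_small (4 * r) _ e0.
  have := lP k; have := uball k; have := normcD (l - u k) (u k - c).
  by rewrite addrA subrK; lra.
exists l => //; apply/eqP; rewrite -subr_eq0; apply/contraT => neq.
(* Both |T l - T u_k| and |u_(k+1) - l| are at most 2 r / 2^k, which falls short of |T l - l| for
   large k. *)
have e0 : 0 < normc (T l - l) / 2 by rewrite divr_gt0 ?normc_gt0.
have [k] := geometric_small (4 * r) _ e0.
have h1 := lP k; have h2 := lP k.+1.
have h3 := Tlip _ _ lball (uball k).
have := normcD (T l - T (u k)) (u k.+1 - l).
rewrite /= addrA subrK (normcB (T (u k))).
have h4 : 4 * r / 2 ^+ k.+1 = 4 * r / 2 ^+ k / 2 by rewrite exprSr invfM mulrA.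
by move: h2; rewrite h4 /=; lra.
Qed.

End GeometricLimit.

(** * Derivatives of a product of linear factors through its logarithmic derivative *)

Section LogDeriv.
Context {R : realType}.
Implicit Types (s : seq R[i]) (z : R[i]).

Definition log_deriv s z : R[i] := \sum_(x <- s) (z - x)^-1.

Definition prod_roots s : {poly R[i]} := \prod_(x <- s) ('X - x%:P).

Lemma prod_roots_neq0 s z : z \notin s -> (prod_roots s).[z] != 0.
Proof.
by move=> zs; rewrite -[_ == 0]/(root _ z) /prod_roots root_prod_XsubC.
Qed.

Lemma deriv_prod_roots s z : z \notin s ->
  (prod_roots s)^`().[z] = (prod_roots s).[z] * log_deriv s z.
Proof.
rewrite /prod_roots /log_deriv.
elim: s => [|x s IH]; first by rewrite !big_nil derivC !hornerE.
rewrite inE negb_or !big_cons => /andP[zx zs].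
rewrite derivM derivXsubC mul1r hornerD !hornerM hornerXsubC IH //.
by field; rewrite subr_eq0.
Qed.

(** This is q'' = q (L^2 + L'), with L' already expanded as minus the sum of the (z - x)^-2. *)
Lemma deriv2_prod_roots s z : z \notin s ->
  (prod_roots s)^`()^`().[z] = (prod_roots s).[z] *
    (log_deriv s z ^+ 2 - \sum_(x <- s) (z - x)^-1 ^+ 2).
Proof.
rewrite /prod_roots /log_deriv.
elim: s => [|x s IH].
  by rewrite !big_nil !derivC !hornerE expr0n ?subrr ?mulr0.
rewrite inE negb_or => /andP[zx zs].
have D := deriv_prod_roots s z zs; rewrite /prod_roots /log_deriv in D.
rewrite !big_cons derivM derivXsubC mul1r derivD derivM derivXsubC mul1r.
rewrite !(hornerXsubC, hornerD, hornerM) IH // D.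
by field; rewrite subr_eq0.
Qed.

Lemma root_deriv_XsubC_mul s x z : z \notin s ->
  root (('X - x%:P) * prod_roots s)^`() z = (1 + (z - x) * log_deriv s z == 0).
Proof.
move=> zs; rewrite /root derivM derivXsubC mul1r hornerD hornerM hornerXsubC.
rewrite deriv_prod_roots // mulrCA -[X in X + _]mulr1 -mulrDr mulf_eq0.
by rewrite (negPf (prod_roots_neq0 _ _ zs)).
Qed.

(* p'' / q at a critical point, q being the product of the other factors *)
Lemma deriv2_XsubC_mul s x z : z \notin s ->
  1 + (z - x) * log_deriv s z = 0 ->
  log_deriv s z * (('X - x%:P) * prod_roots s)^`()^`().[z] =
  (prod_roots s).[z] *
    (log_deriv s z ^+ 2 + \sum_(y <- s) (z - y)^-1 ^+ 2).
Proof.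
move=> zs h; rewrite derivM derivXsubC mul1r derivD derivM derivXsubC mul1r.
rewrite !(hornerXsubC, hornerD, hornerM) deriv_prod_roots //.
rewrite deriv2_prod_roots //.
move: (\sum_(y <- s) _) (log_deriv s z) h => A L h.
have dL : (z - x) * L = -1 by apply/eqP; rewrite -addr_eq0 addrC h.
set q := _.[z]; transitivity (2 * q * L ^+ 2 + (z - x) * L * q * (L ^+ 2 - A)).
  by ring.
by rewrite dL; ring.
Qed.

End LogDeriv.

(** Used with a derivative in place of p, so that the outlying critical point is unique also when
    counted with multiplicity. *)
Lemma mup_simple_root (F : fieldType) (p : {poly F}) (w : F) :
  root p w -> ~~ root p^`() w -> mup w p = 1%N.
Proof.
move=> /factor_theorem[q ->]; rewrite derivM derivXsubC mulr1 => nr.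
have qw : ~~ root q w.
  by move: nr; rewrite /root hornerD hornerM hornerXsubC subrr mulr0 add0r.
by rewrite mupMr // (@mup_XsubCX _ 1 w w) eqxx.
Qed.

(** * A deterministic criterion for a single outlying critical point *)

Section Outlier.
Context {R : realType}.
Variables (s : seq R[i]) (xi : R[i]) (G : set R[i]) (b c n : R).
(** In the application n is the degree and G the complement of N_mu(2 eps). The bound [cn2] makes T
    preserve the disc; [bcn2] makes T a contraction with constant 1/2 and the critical point
    simple. *)
Hypotheses (b0 : 0 < b) (c0 : 0 < c) (n0 : 0 < n) (sn : (size s)%:R <= n).
Hypotheses (cn2 : 2 <= c * n) (bcn2 : 2 <= b ^+ 2 * c ^+ 2 * n).
Hypothesis far : forall z x : R[i], G z -> x \in s -> b * (1 + normc z) <= normc (z - x).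
Hypothesis low : forall z : R[i], G z -> c * n <= normc (log_deriv s z) * (1 + normc z).
Hypothesis ball : forall z : R[i], normc (z - xi) <= 2 / (c * n) * (1 + normc xi) -> G z.

Let D (z : R[i]) : R := 1 + normc z.
Let D0 z : 0 < D z. Proof. by have := normc_ge0 z; rewrite /D; lra. Qed.
Let cn0 : 0 < c * n. Proof. exact: mulr_gt0. Qed.
Let L0 z : G z -> 0 < normc (log_deriv s z).
Proof.
by move=> Gz; have := lt_le_trans cn0 (low _ Gz); rewrite pmulr_lgt0 // D0.
Qed.
Let Lneq0 z : G z -> log_deriv s z != 0.
Proof. by move=> /L0; apply: contraTneq => ->; rewrite normc0 ltxx. Qed.
Let Gs z : G z -> z \notin s.
Proof.
move=> Gz; apply/negP => /(far _ _ Gz); rewrite subrr normc0 leNgt.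
by rewrite mulr_gt0 ?D0.
Qed.

Let inv_far z x : G z -> x \in s -> normc (z - x)^-1 <= (b * D z)^-1.
Proof.
move=> Gz xs; rewrite normcV lef_pV2 ?posrE ?mulr_gt0 ?D0 //.
  exact: far.
by apply: lt_le_trans (far _ _ Gz xs); rewrite mulr_gt0 ?D0.
Qed.

Let sum_bound (F : R[i] -> R[i]) (B : R) : 0 <= B ->
  (forall x, x \in s -> normc (F x) <= B) ->
  normc (\sum_(x <- s) F x) <= n * B.
Proof.
move=> B0 FB; apply: le_trans (normc_sum _ _ _) _.
apply: (@le_trans _ _ (\sum_(x <- s) B)).
  by rewrite big_seq [leRHS]big_seq; apply: ler_sum.
by rewrite big_const_seq count_predT iter_addr_0 -mulr_natl ler_wpM2r.
Qed.

Let inv_L z : G z -> normc (log_deriv s z)^-1 <= D z / (c * n).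
Proof.
move=> Gz; rewrite normcV -[X in X <= _]mul1r ler_pdivrMr ?L0 // mulrAC.
by rewrite ler_pdivlMr // mul1r [leRHS]mulrC low.
Qed.

Let lipschitz z w : G z -> G w ->
  normc (log_deriv s z - log_deriv s w) <=
    normc (z - w) * (n / (b ^+ 2 * D z * D w)).
Proof.
move=> Gz Gw; rewrite -sumrB mulrCA; apply: sum_bound.
  by rewrite mulr_ge0 ?normc_ge0 // invr_ge0 !mulr_ge0 ?ltW ?D0 ?exprn_gt0.
move=> x xs.
have zx : z - x != 0 by rewrite subr_eq0; apply: contraTneq xs => <-; exact: Gs.
have wx : w - x != 0 by rewrite subr_eq0; apply: contraTneq xs => <-; exact: Gs.
have -> : (z - x)^-1 - (w - x)^-1 = - ((z - w) * ((z - x)^-1 * (w - x)^-1)).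
  by field; rewrite zx wx.
rewrite normcN !normcM ler_wpM2l ?normc_ge0 //.
have -> : (b ^+ 2 * D z * D w)^-1 = (b * D z)^-1 * (b * D w)^-1.
  by field; rewrite !gt_eqF ?D0.
by rewrite ler_pM ?normc_ge0 ?inv_far.
Qed.

Let T z := xi - (log_deriv s z)^-1.

(** The weights [D z] and [D w] in [lipschitz] cancel against those in [inv_L], so the constant
    1/(b^2 c^2 n) is uniform over G, however large z and w are. *)
Let T_lip z w : G z -> G w -> normc (T z - T w) <= normc (z - w) / 2.
Proof.
move=> Gz Gw.
have -> : T z - T w = (log_deriv s z - log_deriv s w) *
   ((log_deriv s z)^-1 * (log_deriv s w)^-1).
  by rewrite /T; field; rewrite !Lneq0.
rewrite !normcM.
apply: (@le_trans _ _ (normc (z - w) * (n / (b ^+ 2 * D z * D w)) *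
   (D z / (c * n) * (D w / (c * n))))).
  by rewrite ler_pM ?mulr_ge0 ?normc_ge0 ?lipschitz // ler_pM ?normc_ge0 ?inv_L.
have -> : normc (z - w) * (n / (b ^+ 2 * D z * D w)) *
   (D z / (c * n) * (D w / (c * n))) = normc (z - w) / (b ^+ 2 * c ^+ 2 * n).
  by field; rewrite !gt_eqF ?D0.
by rewrite ler_wpM2l ?normc_ge0 // lef_pV2 ?posrE // ?mulr_gt0 ?exprn_gt0.
Qed.

Let p := ('X - xi%:P) * prod_roots s.

Let critP z : G z -> reflect (T z = z) (root p^`() z).
Proof.
move=> Gz; rewrite root_deriv_XsubC_mul ?Gs //; apply: (iffP eqP).
  move=> h; rewrite /T.
  have -> : xi = z - (z - xi) by ring.
  suff -> : z - xi = - (log_deriv s z)^-1 by ring.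
  by apply: (mulIf (Lneq0 _ Gz)); rewrite mulNr mulVf ?Lneq0 //; apply/eqP;
    rewrite -addr_eq0 addrC h.
move=> h; rewrite -{1}h /T.
have -> : xi - (log_deriv s z)^-1 - xi = - (log_deriv s z)^-1 by ring.
by rewrite mulNr mulVf ?Lneq0 // subrr.
Qed.

Let r := 2 / (c * n) * (1 + normc xi).

Let fix_near z : G z -> normc (T z - xi) <= D z / (c * n).
Proof.
move=> Gz; rewrite /T (_ : xi - _ - xi = - (log_deriv s z)^-1); last by ring.
by rewrite normcN inv_L.
Qed.

(** From |z - xi| <= (1 + |z|)/(c n) and |z| <= |z - xi| + |xi|; since c n >= 2, the term |z - xi|
    is absorbed on the left, at the cost of the factor 2 in r. *)
Let crit_ball z : G z -> root p^`() z -> normc (z - xi) <= r.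
Proof.
move=> Gz /critP h; have {}h := h Gz.
have := fix_near _ Gz; rewrite h ler_pdivlMr // /r mulrAC ler_pdivlMr // /D.
have := normcD (z - xi) xi; rewrite subrK.
by have := ler_wpM2l (normc_ge0 (z - xi)) cn2; lra.
Qed.

Lemma outlier_critical_point : exists w1, [/\ root p^`() w1, G w1,
  (forall w, root p^`() w -> G w -> w = w1),
  mup w1 p^`() = 1%N & normc (w1 - xi) <= r].
Proof.
have r0 : 0 <= r.
  by rewrite /r mulr_ge0 ?divr_ge0 ?ltW ?D0.
have [||w wr Tw] := @complex_contraction _ T xi r r0.
- move=> z zr; apply: le_trans (fix_near _ (ball _ zr)) _.
  rewrite /r mulrAC ler_pM2r ?invr_gt0 //.
  (* Hence 1 + |z| <= 2 (1 + |xi|) on the disc, and [fix_near] returns the radius r. *)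
  have : r <= 1 + normc xi.
    by apply: ler_piMl; [exact: ltW (D0 xi)|rewrite ler_pdivrMr ?mul1r].
  by have := normcD (z - xi) xi; rewrite subrK /D; lra.
- by move=> z w zr wr; apply: T_lip; exact: ball.
have Gw := ball _ wr; have rw : root p^`() w by apply/critP.
exists w; split => //.
(* [T_lip] holds on all of G, so two fixed points there satisfy |v - w| <= |v - w| / 2. *)
- move=> v rv Gv; have /critP Tv := rv.
  have := T_lip _ _ Gv Gw; rewrite Tv // Tw => h.
  apply/eqP; rewrite -subr_eq0; apply/eqP/eq0_normc.
  by have := normc_ge0 (v - w); lra.
(* At a multiple root L^2 would equal minus the sum of the (w - x)^-2. With D = 1 + |w|, the left
   side is at least c^2 n^2 / D^2 in modulus and the right side at most n / (b^2 D^2), against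
   [bcn2]. *)
- apply: mup_simple_root => //; apply/negP => /eqP rw2.
  move: rw; rewrite root_deriv_XsubC_mul ?Gs // => /eqP rw.
  have := deriv2_XsubC_mul _ _ _ (Gs _ Gw) rw; rewrite rw2 mulr0 => /esym/eqP.
  rewrite mulf_eq0 (negPf (prod_roots_neq0 _ _ (Gs _ Gw))) /= addr_eq0 => /eqP e.
  have h1 : normc (log_deriv s w ^+ 2) <= n * ((b * D w)^-1) ^+ 2.
    rewrite e normcN; apply: sum_bound; first exact: sqr_ge0.
    move=> x xs; rewrite !expr2 normcM.
    by rewrite ler_pM ?normc_ge0 ?inv_far.
  have h2 : (c * n / D w) ^+ 2 <= normc (log_deriv s w ^+ 2).
    rewrite !expr2 normcM.
    have h : c * n / D w <= normc (log_deriv s w).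
      by rewrite ler_pdivrMr ?D0 // low.
    by rewrite ler_pM // divr_ge0 ?ltW ?D0.
  have := le_trans h2 h1.
  have -> : (c * n / D w) ^+ 2 =
    (b ^+ 2 * c ^+ 2 * n) * (n * (b * D w)^-1 ^+ 2).
    by field; rewrite !gt_eqF ?D0.
  have : 0 < n * (b * D w)^-1 ^+ 2.
    by rewrite mulr_gt0 ?exprn_gt0 ?invr_gt0 ?mulr_gt0 ?D0.
  move: (n * _) => Q Q0; have := ler_wpM2r (ltW Q0) bcn2; lra.
Qed.

End Outlier.

(** * Integrals of bounded functions against a probability measure *)

Section BoundedIntegral.
Context d (T : measurableType d) (R : realType) (P : probability T R).

Lemma bounded_measurable_integrable (f : T -> R) (B : R) :
  measurable_fun setT f -> (forall x, `|f x| <= B) ->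
  P.-integrable setT (EFin \o f).
Proof.
move=> mf fB; apply: measurable_bounded_integrable => //.
  exact: le_lt_trans (probability_le1 P measurableT) (ltry 1).
exists B; split; first exact: num_real.
by move=> M BM x _; exact: le_trans (fB x) (ltW BM).
Qed.

Lemma Rintegral_prob_cst (r : R) : (\int[P]_(x in setT) r)%R = r.
Proof. by rewrite Rintegral_cst //= probability_setT mulr1. Qed.

Lemma Rintegral_sum_seq (I : Type) (s : seq I) (F : I -> T -> R) :
  (forall i, P.-integrable setT (EFin \o F i)) ->
  (\int[P]_x \sum_(i <- s) F i x = \sum_(i <- s) \int[P]_x F i x)%R.
Proof.
move=> Fi; elim: s => [|i s IH].
  by rewrite big_nil; under eq_Rintegral do rewrite big_nil;
    rewrite Rintegral_cst // mul0r.
under eq_Rintegral do rewrite big_cons.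
rewrite RintegralD // ?big_cons ?IH //.
rewrite (_ : EFin \o _ = (fun x => \sum_(j <- s) (F j x)%:E)%E); last first.
  by apply/funext => x /=; rewrite sumEFin.
by apply: integrable_sum => // j _; exact: Fi.
Qed.

End BoundedIntegral.

(** * Expectation of a product of two independent variables *)

Section PairIndependence.
Context d (T : measurableType d) (R : realType) (P : probability T R).
Context d' (E : measurableType d') (mu : probability E R).
Variables (Y Z : T -> E).
Hypotheses (mY : measurable_fun setT Y) (mZ : measurable_fun setT Z).

(** The law of (Y, Z) agrees with mu x mu on rectangles, hence everywhere by uniqueness of the
    product measure; Fubini then splits the integral. *)
Lemma Rintegral_indep_mul (h : E -> R) (B : R) :
  (forall A1 A2, measurable A1 -> measurable A2 ->
     P ((Y @^-1` A1) `&` (Z @^-1` A2)) = (mu A1 * mu A2)%E) ->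
  measurable_fun setT h -> (forall x, `|h x| <= B) ->
  (\int[P]_w (h (Y w) * h (Z w)) = (\int[mu]_x h x) * (\int[mu]_x h x))%R.
Proof.
move=> ind mh hB.
pose YZ w := (Y w, Z w).
have mYZ : measurable_fun setT YZ by exact: measurable_fun_pair.
pose hh (z : E * E) : R := h z.1 * h z.2.
have mhh : measurable_fun setT hh.
  by apply: measurable_funM; exact: measurableT_comp.
have hhB z : `|hh z| <= B * B by rewrite normrM ler_pM.
have ih := bounded_measurable_integrable _ _ _ mu h B mh hB.
have i1 : P.-integrable (YZ @^-1` setT) ((EFin \o hh) \o YZ).
  rewrite preimage_setT.
  apply: (@bounded_measurable_integrable _ _ _ P (hh \o YZ) (B * B)).
    exact: measurableT_comp.
  by move=> w; exact: hhB.
have /measurable_EFinP mhh' := mhh.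
have e1 : (\int[P]_w ((h (Y w) * h (Z w))%:E) =
   \int[mu \x mu]_z (hh z)%:E)%E.
  transitivity (\int[pushforward P YZ]_y (EFin \o hh) y)%E.
    by rewrite (@integral_pushforward _ _ _ _ _ YZ mYZ P setT _ mhh' i1).
  apply: eq_measure_integral => A mA _; apply/esym.
  by apply: (@product_measure_unique _ _ _ _ _ mu mu (pushforward P YZ)).
have i2 : (mu \x mu)%E.-integrable setT (EFin \o hh).
  apply/integrableP; split => //.
  apply: (@le_lt_trans _ _ (\int[mu \x mu]_(x in setT) (B * B)%:E)%E).
    apply: ge0_le_integral => //=.
      by apply/measurable_EFinP; exact: measurableT_comp.
    by move=> x _; rewrite lee_fin.
  have e : (mu \x mu)%E setT = 1%E.
    by rewrite -setXTT product_measure1E //= !probability_setT mule1.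
  by rewrite integral_cst //= [X in (_ * X)%E]e mule1 ltry.
rewrite /Rintegral e1 -integral12_prod_meas1 //=.
pose I := (\int[mu]_x h x)%R.
have hI : (\int[mu]_y (h y)%:E = I%:E)%E.
  by rewrite fineK //; exact: integrable_fin_num.
rewrite (_ : (fun x => _) = fun x => ((h x)%:E * I%:E)%E); last first.
  by apply/funext => x; rewrite -hI -integralZl //.
by rewrite integralZr //= hI.
Qed.

End PairIndependence.

(** * Strong law of large numbers for bounded variables *)

Lemma nat_sqrt_floor (n : nat) : exists k : nat, (k ^ 2 <= n < k.+1 ^ 2)%N.
Proof.
elim: n => [|n [k /andP[h1 h2]]]; first by exists 0%N.
have [h|h] := ltnP n.+1 (k.+1 ^ 2)%N.
  by exists k; rewrite h andbT (leq_trans h1).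
exists k.+1; rewrite h /=; apply: leq_ltn_trans h2 _.
by rewrite ltn_exp2r.
Qed.

Lemma sum_inv_sqr_le2 (R : realType) (n : nat) :
  \sum_(0 <= k < n) (k.+1%:R ^- 2 : R) <= 2.
Proof.
(* The sharper bound passes through the induction because 1/x - 1/(x+1) - 1/(x+1)^2 = 1/(x (x+1)^2)
   >= 0. At n = 0 it reads 0 <= 2, the inverse of 0 being 0. *)
suff h : \sum_(0 <= k < n) (k.+1%:R ^- 2 : R) <= 2 - n%:R^-1.
  by apply: le_trans h _; rewrite gerBl invr_ge0.
elim: n => [|[|n] IH]; first by rewrite big_geq // invr0; lra.
  by rewrite big_nat1 expr1n invr1; lra.
rewrite big_nat_recr //=; apply: le_trans (lerD IH (lexx _)) _.
have x0 : 0 < n.+1%:R :> R by [].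
rewrite -[n.+2%:R]natr1; move: (n.+1%:R) x0 => x x0.
rewrite -subr_ge0.
have -> : 2 - (x + 1)^-1 - (2 - x^-1 + (x + 1) ^- 2) = (x * (x + 1) ^+ 2)^-1.
  by field; rewrite !gt_eqF //; lra.
by rewrite invr_ge0 mulr_ge0 ?sqr_ge0 ?ltW.
Qed.

Section StrongLaw.
Context d (T : measurableType d) (R : realType) (P : probability T R).
Context d' (E : measurableType d') (mu : probability E R).
Variable X : nat -> T -> E.
Hypothesis mX : forall j, measurable_fun setT (X j).
(** Pairwise independence and the common law in one condition: A2 = [setT] gives the law of X i. A
    second moment argument asks for no more. *)
Hypothesis indX : forall i j A1 A2, i != j -> measurable A1 -> measurable A2 ->
  P ((X i @^-1` A1) `&` (X j @^-1` A2)) = (mu A1 * mu A2)%E.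

Section Centered.
Variables (g : E -> R) (B : R).
Hypotheses (mg : measurable_fun setT g) (gB : forall x, `|g x| <= B).
Hypothesis g0 : (\int[mu]_x g x = 0)%R.

Let S n w := \sum_(j < n) g (X j w).

Let B0 : 0 <= B.
Proof. exact: le_trans (gB (X 0%N point)). Qed.

Let mgX j : measurable_fun setT (g \o X j).
Proof. exact: measurableT_comp. Qed.

Let mS n : measurable_fun setT (S n).
Proof. by apply: measurable_sum => j; exact: mgX. Qed.

Let Sbound n w : `|S n w| <= n%:R * B.
Proof.
apply: le_trans (ler_norm_sum _ _ _) _.
have -> : n%:R * B = \sum_(j < n) B by rewrite sumr_const card_ord mulr_natl.
exact: ler_sum.
Qed.

Let cross n : (\int[P]_w (S n w * g (X n w)) = 0)%R.
Proof.
under eq_Rintegral do rewrite mulr_suml.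
rewrite Rintegral_sum_seq.
  rewrite big1 // => j _.
  rewrite (@Rintegral_indep_mul _ _ _ P _ _ mu (X j) (X n) _ _ g B) //.
    by rewrite g0 mulr0.
  by move=> A1 A2; apply: indX; rewrite neq_ltn ltn_ord.
move=> j; apply: (@bounded_measurable_integrable _ _ _ P _ (B * B)).
  by apply: measurable_funM; exact: mgX.
by move=> w; rewrite normrM ler_pM.
Qed.

(** The cross terms vanish, so each new summand adds at most B^2: the growth is linear in n instead
    of quadratic. *)
Let second_moment n : (\int[P]_w (S n w ^+ 2) <= n%:R * B ^+ 2)%R.
Proof.
elim: n => [|n IH].
  rewrite mul0r; under eq_Rintegral do rewrite /S big_ord0 expr0n.
  by rewrite Rintegral_cst // mul0r.
have e w : S n.+1 w ^+ 2 =
    S n w ^+ 2 + 2 * (S n w * g (X n w)) + g (X n w) ^+ 2.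
  by rewrite /S big_ord_recr /=; ring.
have iS : P.-integrable setT (EFin \o (fun w => S n w ^+ 2)).
  apply: (@bounded_measurable_integrable _ _ _ P _ ((n%:R * B) ^+ 2)).
    by apply: measurable_funX.
  by move=> w; rewrite normrX ler_pXn2r ?nnegrE ?mulr_ge0.
have iSg : P.-integrable setT (EFin \o (fun w => S n w * g (X n w))).
  apply: (@bounded_measurable_integrable _ _ _ P _ (n%:R * B * B)).
    by apply: measurable_funM => //; exact: mgX.
  by move=> w; rewrite normrM ler_pM.
have i2Sg : P.-integrable setT (EFin \o (fun w => 2 * (S n w * g (X n w)))).
  by apply: (@integrableZl _ _ _ P setT measurableT 2 _ iSg).
have igg : P.-integrable setT (EFin \o (fun w => g (X n w) ^+ 2)).
  apply: (@bounded_measurable_integrable _ _ _ P _ (B ^+ 2)).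
    by apply: measurable_funX; exact: mgX.
  by move=> w; rewrite normrX ler_pXn2r ?nnegrE.
under eq_Rintegral do rewrite e.
have iSS : P.-integrable setT
    (EFin \o (fun w => S n w ^+ 2 + 2 * (S n w * g (X n w)))).
  exact: (@integrableD _ _ _ P setT measurableT _ _ iS i2Sg).
rewrite RintegralD //.
rewrite RintegralD // RintegralZl // cross mulr0 addr0.
rewrite -natr1 mulrDl mul1r lerD //.
rewrite -[leRHS](Rintegral_prob_cst _ _ _ P).
apply: le_Rintegral => //.
  by apply: (@bounded_measurable_integrable _ _ _ P _ `|B ^+ 2|).
by move=> w _; rewrite -real_normK ?num_real // ler_pXn2r ?nnegrE.
Qed.

Let phi k w := (S (k.+1 ^ 2) w / (k.+1 ^ 2)%:R) ^+ 2.

Let mphi k : measurable_fun setT (phi k).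
Proof. by apply: measurable_funX; apply: measurable_funM. Qed.

Let int_phi k : (\int[P]_w (phi k w)%:E <= (B ^+ 2 * k.+1%:R ^- 2)%:E)%E.
Proof.
have N0 : 0 < (k.+1 ^ 2)%:R :> R by rewrite ltr0n expn_gt0.
have iphi : P.-integrable setT (EFin \o phi k).
  apply: (@bounded_measurable_integrable _ _ _ P _ (B ^+ 2)) => // w.
  rewrite /phi normrX ler_pXn2r ?nnegrE // normrM normfV (gtr0_norm N0).
  by rewrite ler_pdivrMr // mulrC.
rewrite -[X in (X <= _)%E]fineK; last exact: integrable_fin_num.
rewrite lee_fin.
rewrite [leLHS](_ : _ = (\int[P]_w phi k w)%R) //.
under eq_Rintegral do rewrite /phi exprMn.
rewrite RintegralZr //; last first.
  apply: (@bounded_measurable_integrable _ _ _ P _ (((k.+1 ^ 2)%:R * B) ^+ 2)).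
    by apply: measurable_funX.
  by move=> w; rewrite normrX ler_pXn2r ?nnegrE ?mulr_ge0.
apply: (@le_trans _ _ ((k.+1 ^ 2)%:R * B ^+ 2 * (k.+1 ^ 2)%:R^-1 ^+ 2)).
  by rewrite ler_wpM2r ?sqr_ge0.
have : k.+1%:R != 0 :> R by rewrite pnatr_eq0.
rewrite natrX le_eqVlt; move: (k.+1%:R) => x x0; apply/orP; left; apply/eqP.
by field.
Qed.

(* The second moments along n = k^2 are summable; boundedness takes care of the
   indices between two consecutive squares. *)
Lemma sqr_averages_cvg0 :
  {ae P, forall w, phi ^~ w @ \oo --> (0 : R)}.
Proof.
pose F w := (\sum_(k <oo) (phi k w)%:E)%E.
have phi0 k w : (0 <= (phi k w)%:E)%E by rewrite lee_fin sqr_ge0.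
have mF : measurable_fun setT F.
  by apply: ge0_emeasurable_sum => // k _; apply/measurable_EFinP.
have F0 w : (0 <= F w)%E by apply: nneseries_ge0.
(* By monotone convergence the integral of F is at most 2 B^2. So F is finite almost surely, and the
   terms of a convergent series tend to 0. *)
have iF : P.-integrable setT F.
  apply/integrableP; split => //.
  under eq_integral => w _ do rewrite gee0_abs //.
  rewrite integral_nneseries //; last by move=> k; apply/measurable_EFinP.
  apply: (@le_lt_trans _ _ (B ^+ 2 * 2)%:E); last exact: ltry.
  apply: lime_le.
    by apply: is_cvg_nneseries => k _ _; apply: integral_ge0.
  apply: nearW => n.
  apply: (@le_trans _ _ (\sum_(0 <= k < n) (B ^+ 2 * k.+1%:R ^- 2)%:E)%E).
    by apply: lee_sum => k _.
  by rewrite sumEFin lee_fin -mulr_sumr ler_wpM2l ?sqr_ge0 ?sum_inv_sqr_le2.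
have := integrable_ae measurableT iF.
apply: filterS => w /(_ I) Fw.
apply: cvg_series_cvg_0; apply: nondecreasing_is_cvgn.
  by apply: nondecreasing_series => k _ _; exact: sqr_ge0.
exists (fine (F w)) => _ [n _ <-].
rewrite -lee_fin fineK // /series /= -sumEFin.
exact: nneseries_lim_ge.
Qed.

Lemma slln_centered :
  {ae P, forall w, forall e, 0 < e -> exists N, forall n, (N <= n)%N ->
     `|S n w| <= e * n%:R}.
Proof.
apply: filterS sqr_averages_cvg0 => w phiw e e0.
have /cvgrPdist_lt /(_ ((e / 2) ^+ 2)) := phiw.
move=> /(_ ltac:(rewrite exprn_gt0 // divr_gt0 //)) [K _ KP].
(* Beyond K the averages along squares are below e/2. Beyond 4 B / e the at most 2 (k + 1) summands
   after the square (k + 1)^2 contribute at most (e/2) (k + 1)^2. *)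
pose K2 := maxn K (Num.truncn (4 * B / e)).+1.
exists (K2.+1 ^ 2)%N => n nN.
(* Root 0 is impossible as n >= (K2 + 1)^2; otherwise k + 1 is the integer square root, matching the
   shift in [phi]. *)
have [[|k] /andP[kn nk]] := nat_sqrt_floor n.
  by move: (leq_trans nN nk) => //; rewrite leqNgt ltnS expn_gt0.
have Kk : (K2 <= k)%N.
  by have := leq_ltn_trans nN nk; rewrite ltn_exp2r // ltnS.
have k1 : 4 * B / e < k.+1%:R.
  apply: (lt_le_trans (truncnS_gt _)); rewrite ler_nat.
  by rewrite (leq_trans (leq_maxr K _)) // (leq_trans Kk).
have N0 : 0 < (k.+1 ^ 2)%:R :> R by rewrite ltr0n expn_gt0.
have Sk : `|S (k.+1 ^ 2) w| <= e / 2 * (k.+1 ^ 2)%:R.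
  have := KP k (leq_trans (leq_maxl _ _) Kk).
  have e20 : 0 <= e / 2 by rewrite divr_ge0 ?ltW.
  rewrite /= sub0r normrN /phi normrX ltr_pXn2r ?nnegrE //.
  by rewrite normrM normfV (gtr0_norm N0) ltr_pdivrMr // => /ltW.
have Sn : `|S n w - S (k.+1 ^ 2) w| <= (n - k.+1 ^ 2)%:R * B.
  rewrite /S -!(big_mkord xpredT (fun j => g (X j w))).
  rewrite (@big_cat_nat _ _ _ (k.+1 ^ 2)%N) //=.
  rewrite [X in `|X|]addrAC subrr add0r.
  apply: le_trans (ler_norm_sum _ _ _) _.
  apply: (@le_trans _ _ (\sum_(k.+1 ^ 2 <= j < n) B)); first exact: ler_sum.
  by rewrite big_const_nat iter_addr_0 mulr_natl.
have nk2 : (n - k.+1 ^ 2)%:R <= 2 * k.+1%:R :> R.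
  rewrite -natrM ler_nat leq_subLR.
  by move: nk; rewrite -[k.+2]addn1 sqrnD; move: (k.+1) => m; lia.
apply: (@le_trans _ _ (e * (k.+1 ^ 2)%:R)); last by rewrite ler_pM2l // ler_nat.
have h1 : (n - k.+1 ^ 2)%:R * B <= e / 2 * (k.+1 ^ 2)%:R.
  apply: le_trans (ler_wpM2r B0 nk2) _.
  rewrite natrX expr2; move: k1; rewrite ltr_pdivrMr // => k1.
  have := ler_wpM2r (ler0n R k.+1) (ltW k1); lra.
have := ler_normD (S n w - S (k.+1 ^ 2) w) (S (k.+1 ^ 2) w).
rewrite subrK; lra.
Qed.

End Centered.

Lemma slln_bounded (h : E -> R) (B : R) :
  measurable_fun setT h -> (forall x, `|h x| <= B) ->
  {ae P, forall w, forall e, 0 < e -> exists N, forall n, (N <= n)%N ->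
     `|\sum_(j < n) h (X j w) - n%:R * (\int[mu]_x h x)%R| <= e * n%:R}.
Proof.
move=> mh hB; set m := (\int[mu]_x h x)%R.
have ih := bounded_measurable_integrable _ _ _ mu h B mh hB.
have := @slln_centered (fun x => h x - m) (B + `|m|).
have -> : \int[mu]_x (h x - m) = 0.
  rewrite RintegralB //; first by rewrite Rintegral_prob_cst subrr.
  by apply: (@bounded_measurable_integrable _ _ _ mu _ `|m|).
move=> H; apply: filterS (H _ _ _) => //.
- move=> w Hw e /Hw[N NP]; exists N => n /NP.
  by rewrite sumrB sumr_const card_ord mulr_natl.
- by apply: measurable_funB.
- by move=> x; rewrite (le_trans (ler_normB _ _)) // lerD2r.
Qed.

End StrongLaw.

(** * Support and logarithmic derivative of the sample *)

Section Support.
Context {R : realType}.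
Implicit Types (z : R[i]) (x : R * R).

Lemma normc_lt_sqr z (r : R) : 0 < r ->
  (normc z < r) = (complex.Re z ^+ 2 + complex.Im z ^+ 2 < r ^+ 2).
Proof.
move=> r0; case: z => a b /=; rewrite -(@ltr_pXn2r _ 2) ?nnegrE ?sqrtr_ge0 ?ltW //.
by rewrite sqr_sqrtr // addr_ge0 ?sqr_ge0.
Qed.

Lemma measurable_cplx_ball z (r : R) : 0 < r ->
  measurable [set x | (`|cplx x - z| < r%:C)%R].
Proof.
move=> r0.
have eRe x : complex.Re (cplx x - z) = x.1 - complex.Re z by case: (z).
have eIm x : complex.Im (cplx x - z) = x.2 - complex.Im z by case: (z).
have mf : measurable_fun setT (fun x : R * R =>
    (x.1 - complex.Re z) ^+ 2 + (x.2 - complex.Im z) ^+ 2).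
  by apply: measurable_funD; apply: measurable_funX; apply: measurable_funB.
have -> : [set x | (`|cplx x - z| < r%:C)%R] = setT `&` (fun x : R * R =>
    (x.1 - complex.Re z) ^+ 2 + (x.2 - complex.Im z) ^+ 2) @^-1` `]-oo, r ^+ 2[.
  apply/seteqP; split => x /=.
    by rewrite normrC_normc ltcR normc_lt_sqr // eRe eIm => h; split; rewrite ?in_itv.
  by rewrite normrC_normc ltcR normc_lt_sqr // eRe eIm => -[_]; rewrite in_itv.
exact: mf.
Qed.

Lemma near_rational_point z (e : R) : 0 < e ->
  exists q : rat * rat, normc (z - Complex (ratr q.1) (ratr q.2)) < e.
Proof.
move=> e0.
have [q1 hq1] := @rat_in_itvoo R (complex.Re z - e / 2) (complex.Re z + e / 2) ltac:(lra).
have [q2 hq2] := @rat_in_itvoo R (complex.Im z - e / 2) (complex.Im z + e / 2) ltac:(lra).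
exists (q1, q2); apply: le_lt_trans (normc_ReIm _) _.
move: hq1 hq2; rewrite !in_itv; case: z => a b /= /andP[h1 h2] /andP[h3 h4].
have k1 : `|a - ratr q1| < e / 2 by rewrite ltr_norml; lra.
have k2 : `|b - ratr q2| < e / 2 by rewrite ltr_norml; lra.
lra.
Qed.

Variable mu : probability (R * R)%type R.

(** The null balls with rational centre and radius 1/(k + 1) are countably many and cover the
    complement of the support: a point with a null ball of radius r lies in such a ball with 1/(k +
    1) < r/2, which is contained in the null one. *)
Lemma ae_supp : {ae mu, forall x, supp mu (cplx x)}.
Proof.
pose ball (q : rat * rat * nat) := [set x : R * R |
  (`|cplx x - Complex (ratr q.1.1) (ratr q.1.2)| < (q.2.+1%:R^-1 : R)%:C)%R].
have mball q : measurable (ball q) by apply: measurable_cplx_ball.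
pose F n := if unpickle n is Some q then
  (if mu (ball q) == 0%E then ball q else set0) else set0.
have : mu.-negligible (\bigcup_n F n).
  apply: negligible_bigcup => n; rewrite /F; case: unpickle => [q|].
    by case: eqP => [m0|_]; [exact/negligibleP|exact: negligible_set0].
  exact: negligible_set0.
apply: negligibleS => x /= /existsNP[r /not_implyP[r0 nr]].
have [k] := ltr_add_invr (ltac:(lra) : 0 < r / 2).
rewrite add0r => kr.
have k0 : 0 < (k.+1%:R^-1 : R) by rewrite invr_gt0.
have [[q1 q2] hq] := near_rational_point (cplx x) _ k0.
pose c := Complex (ratr q1) (ratr q2) : R[i].
have hqr : normc (cplx x - c) < r / 2 := lt_trans hq kr.
have [N FN] : exists N, F N =
    if mu (ball (q1, q2, k)) == 0%E then ball (q1, q2, k) else set0.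
  by exists (pickle (q1, q2, k)); rewrite /F pickleK.
exists N; [exact: I|rewrite {}FN].
have sub : ball (q1, q2, k) `<=` [set y | (`|cplx y - cplx x| < r%:C)%R].
  move=> y; rewrite /ball /= !normrC_normc !ltcR => hy'.
  have hy : normc (cplx y - c) < r / 2 := lt_trans hy' kr.
  apply: le_lt_trans (normc_dist _ c _) _; rewrite (normcB c); lra.
have -> : mu (ball (q1, q2, k)) = 0%E.
  apply/eqP; rewrite -measure_le0.
  apply: (@le_trans _ _ (mu [set y | (`|cplx y - cplx x| < r%:C)%R])).
    by apply: le_measure; rewrite ?inE //; exact: measurable_cplx_ball.
  by rewrite leNgt; apply/negP.
by rewrite eqxx /ball /= normrC_normc ltcR.
Qed.

Lemma measurable_inv : measurable_fun setT (fun x : R => x^-1).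
Proof.
rewrite (_ : setT = [set (0 : R)] `|` ~` [set (0 : R)]); last by rewrite setUv.
apply/measurable_funU => //; first exact: measurableC.
split; first by apply: measurable_fun_set1.
apply: open_continuous_measurable_fun => //.
  rewrite openC; exact: closed_eq.
by move=> x; rewrite inE /= => /eqP x0; exact: inv_continuous.
Qed.

End Support.

(* [compact_cover] requires a pointed topological space. *)
HB.instance Definition _ (A B : ptopologicalType) := Pointed.on (A * B)%type.

Lemma complex_ReD (R : realType) : {morph (@complex.Re R) : x y / x + y}.
Proof. by case=> a b [c e]. Qed.

Lemma complex_ImD (R : realType) : {morph (@complex.Im R) : x y / x + y}.
Proof. by case=> a b [c e]. Qed.

(** * Sums of 1/(z - X_j) over the random sample *)

Section RandomSums.
Context (R : realType) (mu : probability (R * R)%type R).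
Context (d : measure_display) (T : measurableType d) (P : probability T R).
Variable X : nat -> T -> (R * R)%type.
Hypothesis mX : forall j, measurable_fun setT (X j).
Hypothesis lawX : forall j (A : set (R * R)%type), measurable A ->
  P (X j @^-1` A) = mu A.
Hypothesis indX : mutually_independent P X.

Let sinv n w z : R[i] := \sum_(j < n) (z - cplx (X j w))^-1.

Lemma mutually_independent_pair i j (A1 A2 : set (R * R)) :
  i != j -> measurable A1 -> measurable A2 ->
  P ((X i @^-1` A1) `&` (X j @^-1` A2)) = (mu A1 * mu A2)%E.
Proof.
move=> ij mA1 mA2.
pose A k := if k == i then A1 else A2.
have ji : (j == i) = false by rewrite eq_sym (negPf ij).
have := indX [:: i; j] A.
rewrite /= inE ij big_cons big_seq1 /A eqxx ji !lawX // => <- //.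
  congr (P _); apply/seteqP; split => w /=.
    by move=> [h1 h2] k; rewrite !inE => /orP[]/eqP ->; rewrite ?eqxx ?ji.
  move=> h; split; first by have := h i; rewrite !inE eqxx; apply.
  by have := h j; rewrite !inE eqxx orbT ji; apply.
by move=> k; rewrite !inE => /orP[]/eqP ->; rewrite ?eqxx ?ji.
Qed.

Lemma ae_sample_supp : {ae P, forall w, forall j, supp mu (cplx (X j w))}.
Proof.
apply: ae_foralln => j; have [A [mA A0 sA]] := ae_supp mu.
exists (X j @^-1` A); split.
- by rewrite -[X in measurable X]setTI; exact: mX.
- exact: etrans (lawX j _ mA) A0.
- by move=> w /= h; apply: sA.
Qed.

Section AwayFromSupport.
Variables (z : R[i]) (e : R).
Hypotheses (e0 : 0 < e) (zfar : forall x, supp mu x -> e <= normc (z - x)).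

(* The truncation at e^2 makes the components of 1/(z - x) bounded, and alters
   them only off the support of mu. *)
Let Q (x : R * R) : R := Num.max
  ((complex.Re z - x.1) ^+ 2 + (complex.Im z - x.2) ^+ 2) (e ^+ 2).
Let Q0 x : 0 < Q x. Proof. by rewrite /Q lt_max orbC exprn_gt0. Qed.

Let mre : measurable_fun setT (fun x : R * R => complex.Re z - x.1).
Proof. exact: measurable_funB. Qed.

Let mim : measurable_fun setT (fun x : R * R => complex.Im z - x.2).
Proof. exact: measurable_funB. Qed.

Let mn2 : measurable_fun setT (fun x : R * R =>
  (complex.Re z - x.1) ^+ 2 + (complex.Im z - x.2) ^+ 2).
Proof. by apply: measurable_funD; exact: measurable_funX. Qed.

Let mQ : measurable_fun setT (fun x => (Q x)^-1).
Proof.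
apply: (measurableT_comp (@measurable_inv R)).
by apply: measurable_maxr => //; exact: mn2.
Qed.

(** Both a^2 and e^2 are at most Q, so 2 |a| e <= a^2 + e^2 <= 2 Q. *)
Let Qbound (a : R) x : a ^+ 2 <= (complex.Re z - x.1) ^+ 2 + (complex.Im z - x.2) ^+ 2 ->
  `|a / Q x| <= e^-1.
Proof.
move=> h; rewrite normrM normfV (gtr0_norm (Q0 x)) ler_pdivrMr // mulrC.
rewrite ler_pdivlMr //.
have h1 : `|a| ^+ 2 <= Q x by rewrite real_normK ?num_real // /Q le_max h.
have h2 : e ^+ 2 <= Q x by rewrite /Q le_max lexx orbT.
have := sqr_ge0 (`|a| - e); nra.
Qed.

(** Truncated components of 1/(z - x), that is, of the conjugate of z - x over |z - x|^2; hence the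
    reversed difference in [gim]. *)
Let gre x := (complex.Re z - x.1) / Q x.
Let gim x := (x.2 - complex.Im z) / Q x.

Let Qsupp x : supp mu (cplx x) ->
  Q x = (complex.Re z - x.1) ^+ 2 + (complex.Im z - x.2) ^+ 2.
Proof.
move=> /zfar; rewrite leNgt normc_lt_sqr // -leNgt => h.
by rewrite /Q max_l //; move: h; case: (z).
Qed.

Let gre_supp x : supp mu (cplx x) -> complex.Re (z - cplx x)^-1 = gre x.
Proof. by move=> /Qsupp; rewrite /gre => ->; case: (z). Qed.

Let gim_supp x : supp mu (cplx x) -> complex.Im (z - cplx x)^-1 = gim x.
Proof. by move=> /Qsupp; rewrite /gim => ->; rewrite -[x.2 - _]opprB mulNr; case: (z). Qed.

Let int_ae (f g : R * R -> R) : measurable_fun setT f -> measurable_fun setT g ->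
  (forall x, supp mu (cplx x) -> f x = g x) ->
  (\int[mu]_x f x = \int[mu]_x g x)%R.
Proof.
move=> mf mg fg; congr fine; apply: ae_eq_integral => //.
- exact/measurable_EFinP.
- exact/measurable_EFinP.
- by apply: filterS (ae_supp mu) => x /fg /= ->.
Qed.

Lemma lln_sum_inv : {ae P, forall w, forall e, 0 < e ->
  exists N, forall n, (N <= n)%N ->
    normc (sinv n w z - n%:R * m_mu mu z) <= e * n%:R}.
Proof.
have mgre : measurable_fun setT gre by exact: measurable_funM.
have mgim : measurable_fun setT gim.
  by apply: measurable_funM => //; exact: measurable_funB.
have bre x : `|gre x| <= e^-1 by apply: Qbound; rewrite lerDl sqr_ge0.
have bim x : `|gim x| <= e^-1.
  by apply: Qbound; rewrite -sqrrN opprB lerDr sqr_ge0.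
have minv : measurable_fun setT (fun x : R * R =>
    ((complex.Re z - x.1) ^+ 2 + (complex.Im z - x.2) ^+ 2)^-1).
  exact: (measurableT_comp (@measurable_inv R) mn2).
(* [m_mu] integrates the untruncated components, which agree with [gre] and [gim] mu-almost
   everywhere. *)
have ire : complex.Re (m_mu mu z) = (\int[mu]_x gre x)%R.
  apply: int_ae => //.
  rewrite (_ : (fun x => _) = fun x : R * R => (complex.Re z - x.1) /
    ((complex.Re z - x.1) ^+ 2 + (complex.Im z - x.2) ^+ 2)); last first.
    by apply/funext => x; case: (z).
  exact: measurable_funM.
have iim : complex.Im (m_mu mu z) = (\int[mu]_x gim x)%R.
  apply: int_ae => //.
  rewrite (_ : (fun x => _) = fun x : R * R => (x.2 - complex.Im z) /
    ((complex.Re z - x.1) ^+ 2 + (complex.Im z - x.2) ^+ 2)); last first.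
    by apply/funext => x; rewrite -[x.2 - _]opprB mulNr; case: (z).
  by apply: measurable_funM => //; exact: measurable_funB.
have ind := mutually_independent_pair.
have := @slln_bounded _ _ _ P _ _ mu X mX ind _ _ mgre bre.
have := @slln_bounded _ _ _ P _ _ mu X mX ind _ _ mgim bim.
apply: filterS3 ae_sample_supp => w sw wim wre eta eta0.
have eta20 : 0 < eta / 2 by rewrite divr_gt0.
have [N1 h1] := wre _ eta20; have [N2 h2] := wim _ eta20.
exists (maxn N1 N2) => n; rewrite geq_max => /andP[/h1 {}h1 /h2 {}h2].
apply: le_trans (normc_ReIm _) _.
have nE : (n%:R : R[i]) = Complex n%:R 0 by rewrite -[RHS]/(n%:R%:C) rmorph_nat.
have -> : complex.Re (sinv n w z - n%:R * m_mu mu z) =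
    \sum_(j < n) gre (X j w) - n%:R * (\int[mu]_x gre x)%R.
  rewrite -ire complex_ReD /sinv (big_morph _ (@complex_ReD R) (erefl _)).
  congr (_ + _); first by apply: eq_bigr => j _; exact: gre_supp.
  by rewrite nE; case: (m_mu mu z) => a b /=; rewrite mul0r subr0.
have -> : complex.Im (sinv n w z - n%:R * m_mu mu z) =
    \sum_(j < n) gim (X j w) - n%:R * (\int[mu]_x gim x)%R.
  rewrite -iim complex_ImD /sinv (big_morph _ (@complex_ImD R) (erefl _)).
  congr (_ + _); first by apply: eq_bigr => j _; exact: gim_supp.
  by rewrite nE; case: (m_mu mu z) => a b /=; rewrite mul0r addr0.
lra.
Qed.

End AwayFromSupport.

(** Each z/(z - x) = 1 + x/(z - x) is within M/(2 M) = 1/2 of 1, so z L(z) is within half the size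
    of s of that size. *)
Lemma sum_inv_far (s : seq R[i]) (z : R[i]) (M : R) :
  0 < M -> 3 * M <= normc z -> (forall x, x \in s -> normc x <= M) ->
  (size s)%:R / 2 <= normc (log_deriv s z) * normc z.
Proof.
move=> M0 Mz sM.
have z0 : z != 0 by apply: contraTneq Mz => ->; rewrite normc0 -ltNge; lra.
have far x : x \in s -> 2 * M <= normc (z - x).
  move=> /sM xM; have := normcD (z - x) x; rewrite subrK; lra.
have term x : x \in s -> normc (z / (z - x) - 1) <= 2^-1.
  move=> xs; have h := far _ xs.
  have zx : z - x != 0 by apply: contraTneq h => ->; rewrite normc0 -ltNge; lra.
  have -> : z / (z - x) - 1 = x / (z - x) by field.
  rewrite normcM normcV ler_pdivrMr ?normc_gt0 //.
  by have := sM _ xs; lra.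
have h1 : normc (\sum_(x <- s) (z / (z - x) - 1)) <= (size s)%:R / 2.
  apply: le_trans (normc_sum _ _ _) _.
  apply: (@le_trans _ _ (\sum_(x <- s) (2^-1 : R))).
    by rewrite big_seq [leRHS]big_seq; apply: ler_sum.
  by rewrite big_const_seq count_predT iter_addr_0 mulr_natl.
move: h1; rewrite sumrB -mulr_sumr -/(log_deriv s z) => h1.
have := normc_dist (\sum_(x <- s) 1) (z * log_deriv s z) 0.
rewrite !subr0 normcB normcM.
have -> : normc (\sum_(x <- s) (1 : R[i])) = (size s)%:R.
  by rewrite big_const_seq count_predT iter_addr_0 -(rmorph_nat (real_complex R))
    normc_real normr_nat.
lra.
Qed.

Lemma sample_sumE n w z :
  sinv n w z = log_deriv [seq cplx (X j w) | j <- iota 0 n] z.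
Proof.
rewrite /sinv /log_deriv big_map -(big_mkord xpredT (fun j => (z - cplx (X j w))^-1)).
by rewrite /index_iota subn0.
Qed.

Hypothesis supp_bounded : exists M : R, forall z, supp mu z -> `|z| <= M%:C.

Lemma supp_bound : exists2 M : R, 0 < M &
  forall z, supp mu z -> normc z <= M.
Proof.
have [M hM] := supp_bounded; exists (`|M| + 1); first by have := normr_ge0 M; lra.
move=> z /hM; rewrite normrC_normc lecR => h.
by apply: (le_trans h); have := ler_norm M; lra.
Qed.

Lemma N_mu_far (e : R) (z x : R[i]) :
  ~ N_mu mu e z -> supp mu x \/ M_mu mu x -> e <= normc (z - x).
Proof.
move=> nz hx; rewrite leNgt; apply/negP => h; apply: nz.
by exists x => //; rewrite normrC_normc ltcR.
Qed.

Lemma N_muP (e : R) (z : R[i]) : N_mu mu e z ->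
  exists2 x, supp mu x \/ M_mu mu x & normc (z - x) < e.
Proof. by move=> [x hx]; rewrite normrC_normc ltcR => h; exists x. Qed.

Let sample_exists (Q : T -> Prop) : {ae P, forall w, Q w} -> exists w, Q w.
Proof.
move=> h.
have PF : ProperFilter (almost_everywhere P).
  apply: ae_properfilter_algebraOfSetsType.
  by move: (@lte01 R); rewrite -(probability_setT P).
exact: (@filter_ex _ _ PF _ h).
Qed.

(** A statement about mu alone, read off from one sample path: if |z| > 3 M, the averages of 1/(z -
    X_j) have modulus at least 1/(2 |z|), yet they converge to m_mu(z) = 0. *)
Lemma M_mu_bounded (M : R) (z : R[i]) :
  0 < M -> (forall z, supp mu z -> normc z <= M) -> M_mu mu z ->
  normc z <= 3 * M.
Proof.
move=> M0 sM [zs mz]; rewrite leNgt; apply/negP => Mz.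
have zfar x : supp mu x -> M <= normc (z - x).
  by move=> /sM xM; have := normcD (z - x) x; rewrite subrK; lra.
have z0 : 0 < normc z by lra.
have [w [sw lw]] : exists w, (forall j, supp mu (cplx (X j w))) /\
  (forall e, 0 < e -> exists N, forall n, (N <= n)%N ->
    normc (sinv n w z - n%:R * m_mu mu z) <= e * n%:R).
  apply: sample_exists.
  apply: filterS2 ae_sample_supp (lln_sum_inv _ _ M0 zfar) => w h1 h2.
  by split.
have e0 : 0 < (4 * normc z)^-1 by rewrite invr_gt0 mulr_gt0.
have [N /(_ N.+1 (leqnSn N))] := lw _ e0.
rewrite mz mulr0 subr0 sample_sumE => h.
have := sum_inv_far [seq cplx (X j w) | j <- iota 0 N.+1] z M M0 (ltW Mz).
rewrite size_map size_iota => /(_ _)/wrap[].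
  by move=> _ /mapP[j _ ->]; exact/sM/sw.
have := ler_wpM2r (ltW z0) h.
have -> : (4 * normc z)^-1 * N.+1%:R * normc z = N.+1%:R / 4.
  by field; rewrite gt_eqF.
have : 0 < N.+1%:R :> R by [].
lra.
Qed.

Lemma N_mu_bounded : exists2 B : R, 0 < B &
  forall e z, N_mu mu e z -> normc z <= B + e.
Proof.
have [M M0 sM] := supp_bound.
exists (3 * M) => [|e z /N_muP[x hx zx]]; first by rewrite mulr_gt0.
have xB : normc x <= 3 * M.
  case: hx => [/sM h|]; first by apply: le_trans h _; lra.
  exact: M_mu_bounded.
by have := normcD (z - x) x; rewrite subrK; lra.
Qed.

(** * The uniform lower bound on the random sums outside N_mu(e) *)

Section LowerBound.
Variable e : R.
Hypothesis e0 : 0 < e.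

Let lower_near (z0 : R[i]) : exists dc : R * R, [/\ 0 < dc.1, 0 < dc.2 &
  {ae P, forall w, exists N, forall n, (N <= n)%N ->
    forall z, normc (z - z0) < dc.1 -> ~ N_mu mu e z ->
      dc.2 * n%:R <= normc (sinv n w z)}].
Proof.
(* If z0 lies in N_mu(e), so does a small disc around it, and the claim is vacuous there. Otherwise
   z0 avoids both the support and M_mu, so m_mu(z0) is nonzero. *)
have [/N_muP[x hx zx]|nz] := pselect (N_mu mu e z0).
  exists (e - normc (z0 - x), 1); split => //=; first by rewrite subr_gt0.
  apply: aeW => w; exists 0%N => n _ z h1 nz.
  by have := N_mu_far _ _ _ nz hx; have := normc_dist z z0 x; lra.
have zfar x : supp mu x -> e <= normc (z0 - x).
  by move=> sx; apply: N_mu_far nz _; left.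
have m0 : m_mu mu z0 != 0.
  apply/eqP => m0; apply: nz; exists z0; last by rewrite subrr normr0 ltcR.
  by have [|ns] := pselect (supp mu z0); [left|right; split].
have m1 := normc_gt0 _ m0; set m := normc _ in m1.
(* The averages have Lipschitz constant 1/e^2 off N_mu(e), so moving from z0 to z loses at most m/4;
   the law of large numbers at z0 loses another m/4. *)
exists (e ^+ 2 * m / 4, m / 2); split => /=.
- by rewrite !mulr_gt0 ?exprn_gt0.
- by rewrite divr_gt0.
apply: filterS2 ae_sample_supp (lln_sum_inv _ _ e0 zfar) => w sw lw.
have [|N hN] := lw (m / 4); first by rewrite divr_gt0.
exists N => n /hN h z zz {}nz.
have h1 : normc (sinv n w z - sinv n w z0) <= n%:R * (m / 4).
  rewrite /sinv -sumrB; apply: le_trans (normc_sum _ _ _) _.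
  have -> : n%:R * (m / 4) = \sum_(j < n) (m / 4).
    by rewrite sumr_const card_ord mulr_natl.
  apply: ler_sum => j _; set x := cplx _.
  have zx : e <= normc (z - x) by apply: N_mu_far nz _; left; exact: sw.
  have z0x : e <= normc (z0 - x) by apply: zfar; exact: sw.
  have zx0 : z - x != 0 by apply: contraTneq zx => ->; rewrite normc0 -ltNge.
  have z0x0 : z0 - x != 0 by apply: contraTneq z0x => ->; rewrite normc0 -ltNge.
  have -> : (z - x)^-1 - (z0 - x)^-1 = - ((z - z0) / ((z - x) * (z0 - x))).
    by field; rewrite zx0 z0x0.
  rewrite normcN normcM normcV ler_pdivrMr ?normc_gt0 ?mulf_neq0 // normcM.
  apply: (@le_trans _ _ (m / 4 * (e * e))); first by move: zz; rewrite expr2; lra.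
  apply: ler_wpM2l; first by rewrite divr_ge0 // ltW.
  by apply: ler_pM => //; exact: ltW.
have nm : normc (n%:R * m_mu mu z0) = n%:R * m.
  by rewrite normcM -(rmorph_nat (real_complex R)) normc_real normr_nat.
have := normc_dist (n%:R * m_mu mu z0) (sinv n w z0) 0.
have := normc_dist (sinv n w z0) (sinv n w z) 0.
rewrite !subr0 nm (normcB (n%:R * _)) (normcB (sinv n w z0) (sinv n w z)).
lra.
Qed.

Let lower_finite (dl c : R * R -> R) (s : seq (R * R)) :
  (forall x, 0 < c x) ->
  (forall x, {ae P, forall w, exists N, forall n, (N <= n)%N ->
    forall z, normc (z - cplx x) < dl x -> ~ N_mu mu e z ->
      c x * n%:R <= normc (sinv n w z)}) ->
  exists2 c0, 0 < c0 & {ae P, forall w, exists N, forall n, (N <= n)%N ->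
    forall z x, x \in s -> normc (z - cplx x) < dl x -> ~ N_mu mu e z ->
      c0 * n%:R <= normc (sinv n w z)}.
Proof.
move=> c0 hc; elim: s => [|x s [c1 c10 IH]].
  by exists 1 => //; apply: aeW => w; exists 0%N.
exists (Num.min (c x) c1); first by rewrite lt_min c0.
apply: filterS2 IH (hc x) => w [N1 h1] [N2 h2].
exists (maxn N1 N2) => n; rewrite geq_max => /andP[/h1 {}h1 /h2 {}h2] z y.
rewrite inE => /orP[/eqP ->|ys] zy nz.
  by apply: le_trans (h2 _ zy nz); rewrite ler_wpM2r // ge_min lexx.
by apply: le_trans (h1 _ _ ys zy nz); rewrite ler_wpM2r // ge_min lexx orbT.
Qed.

Let box (r : R) : set (R * R) := `[- r, r]%classic `*` `[- r, r]%classic.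

Lemma ae_sum_inv_lower : exists2 c, 0 < c &
  {ae P, forall w, exists N, forall n, (N <= n)%N ->
    forall z, ~ N_mu mu e z -> c * n%:R <= normc (sinv n w z) * (1 + normc z)}.
Proof.
have [M M0 sM] := supp_bound.
have /choice[dc hdc] : forall x : R * R, exists dc : R * R,
    [/\ 0 < dc.1, 0 < dc.2 &
      {ae P, forall w, exists N, forall n, (N <= n)%N ->
        forall z, normc (z - cplx x) < dc.1 -> ~ N_mu mu e z ->
          dc.2 * n%:R <= normc (sinv n w z)}].
  by move=> x; exact: lower_near.
have cbox : compact (box (3 * M)).
  by apply: compact_setX; exact: segment_compact.
(* Balls of the product are squares; half the radius puts them in the Euclidean disc, since |w| <=
   |Re w| + |Im w|. *)
pose f (x : R * R) := ball x ((dc x).1 / 2).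
have {}cbox : @cover_compact (R * R)%type (box (3 * M)).
  by rewrite -(@compact_cover (R * R)%type).
have [D' _ cov] : finite_subset_cover setT f (box (3 * M)).
  apply: cbox => [x _|x _].
    by apply: ball_open; have [h _ _] := hdc x; rewrite divr_gt0.
  exists x => //; apply: ballxx; have [h _ _] := hdc x; rewrite divr_gt0 //.
have [||c c0 hc] := lower_finite (fun x => (dc x).1) (fun x => (dc x).2) (finmap.enum_fset D').
- by move=> x; have [_ h _] := hdc x.
- by move=> x; have [_ _ h] := hdc x.
(* The constant 1/2 serves |z| >= 3 M, by [sum_inv_far]; c serves the compact square, through the
   finite subcover. *)
exists (Num.min c (1 / 2)); first by rewrite lt_min c0 divr_gt0.
apply: filterS2 ae_sample_supp hc => w sw [N hN]; exists N => n /hN {}hN z nz.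
have [zM|zM] := leP (3 * M) (normc z).
  have := sum_inv_far [seq cplx (X j w) | j <- iota 0 n] z M M0 zM.
  rewrite size_map size_iota -sample_sumE => /(_ _)/wrap[].
    by move=> _ /mapP[j _ ->]; exact/sM/sw.
  have : Num.min c (1 / 2) * n%:R <= 1 / 2 * n%:R.
    by rewrite ler_wpM2r // ge_min lexx orbT.
  have := normc_ge0 (sinv n w z); lra.
have zbox : box (3 * M) (complex.Re z, complex.Im z).
  have h1 := le_lt_trans (normc_Re z) zM; have h2 := le_lt_trans (normc_Im z) zM.
  by split => /=; rewrite in_itv /=; move: h1 h2; rewrite !ltr_norml; lra.
have [x xD [b1' b2']] := cov _ zbox.
have b1 : `|x.1 - complex.Re z| < (dc x).1 / 2 := b1'.
have b2 : `|x.2 - complex.Im z| < (dc x).1 / 2 := b2'.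
have zx : normc (z - cplx x) < (dc x).1.
  apply: le_lt_trans (normc_ReIm _) _.
  rewrite (_ : complex.Re _ = complex.Re z - x.1); last by case: (z).
  rewrite (_ : complex.Im _ = complex.Im z - x.2); last by case: (z).
  by rewrite (distrC _ x.1) (distrC _ x.2); lra.
have h1 := hN _ _ xD zx nz.
have h2 : Num.min c (1 / 2) * n%:R <= c * n%:R.
  by rewrite ler_wpM2r // ge_min lexx.
have := mulr_ge0 (normc_ge0 (sinv n w z)) (normc_ge0 z); lra.
Qed.

End LowerBound.

End RandomSums.

(** * Application to the random polynomial *)

Lemma p_polyE (R : realType) (n : nat) (Y : nat -> R[i]) (xis : seq R[i]) :
  (0 < size xis)%N ->
  p_poly n Y xis = ('X - (xis`_0)%:P) *
    prod_roots ([seq Y j | j <- iota 0 (n - size xis)] ++ behead xis).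
Proof.
case: xis => [//|x s] _; rewrite /p_poly /prod_roots big_cat big_map big_cons /=.
rewrite mulrCA; congr (_ * (_ * _)).
by rewrite -(big_mkord xpredT (fun j => 'X - (Y j)%:P)) /index_iota subn0.
Qed.

Lemma eventually_large (R : realType) (A : R) :
  exists N : nat, forall n, (N <= n)%N -> A <= n%:R.
Proof.
exists (Num.truncn A).+1 => n Nn; apply: le_trans (ltW (truncnS_gt A)) _.
by rewrite ler_nat.
Qed.

Theorem mainTheorem6 (R : realType) (mu : probability (R * R)%type R)
  (d : measure_display) (T : measurableType d) (P : probability T R)
  (X : nat -> T -> (R * R)%type) (xi : nat -> seq R[i]) (eps : R) :
  (* mu has compact support (supp mu is closed, so bounded suffices) *)
  (exists M : R, forall z, supp mu z -> `|z| <= M%:C) ->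
  (* X_1, X_2, ... iid with distribution mu *)
  (forall j, measurable_fun setT (X j)) ->
  (forall j (A : set (R * R)%type), measurable A -> P (X j @^-1` A) = mu A) ->
  mutually_independent P X ->
  (* k_n = size (xi n) is bounded by K independent of n *)
  (exists K : nat, forall n, (size (xi n) <= K)%N) ->
  0 < eps ->
  (* hypotheses for all sufficiently large n *)
  (exists N : nat, forall n, (N <= n)%N ->
     [/\ (0 < size (xi n))%N,
         (forall l, (l < size (xi n))%N ->
            ~ (N_mu mu (3 * eps) (xi n)`_l /\ ~ N_mu mu eps (xi n)`_l)),
         ~ N_mu mu (3 * eps) (xi n)`_0 &
         (forall l, (1 <= l < size (xi n))%N -> N_mu mu eps (xi n)`_l)]) ->
  exists C : R, 0 < C /\
    {ae P, forall w, exists N : nat, forall n, (N <= n)%N ->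
      let p := p_poly n (fun j => cplx (X j w)) (xi n) in
      exists w1 : R[i],
        [/\ root p^`() w1, ~ N_mu mu (2 * eps) w1,
            (forall w', root p^`() w' -> ~ N_mu mu (2 * eps) w' -> w' = w1),
            mup w1 p^`() = 1%N &
            `|w1 - (xi n)`_0| <= (C / n%:R)%:C * (1 + `|(xi n)`_0|)]}.
Proof.
move=> bsupp mX lawX indX [K sK] eps0 [N0 hxi].
have eps20 : 0 < 2 * eps by rewrite mulr_gt0.
have [c0 c00 low] := @ae_sum_inv_lower _ _ _ _ _ _ mX lawX indX bsupp _ eps20.
have [B B0 NB] := @N_mu_bounded _ _ _ _ _ _ mX lawX indX bsupp.
(* For |x| <= B + eps and |z - x| >= eps one gets 1 + |z| <= |z - x| + (1 + B + eps) <= |z - x| /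
   b. *)
pose b := (1 + (1 + B + eps) / eps)^-1.
have b0 : 0 < b.
  by rewrite invr_gt0 addr_gt0 // divr_gt0 //; lra.
pose c := c0 / 2; have cp : 0 < c by rewrite divr_gt0.
(* [K1] lets c = c0/2 absorb the deterministic roots, [K2] and [K3] give the two size conditions of
   the criterion, and [K4] and [K5] keep the disc around xi_1 outside N_mu(2 eps). *)
have [K1 hK1] := eventually_large _ (2 * K%:R + 2 * K%:R / (b * c0)).
have [K2 hK2] := eventually_large _ (2 / c).
have [K3 hK3] := eventually_large _ (2 / (b ^+ 2 * c ^+ 2)).
have [K4 hK4] := eventually_large _ (4 / c).
have [K5 hK5] := eventually_large _ ((4 * (B + 2 * eps) + 5) / (c * eps)).
exists (2 / c); split; first by rewrite divr_gt0.
apply: filterS2 (@ae_sample_supp _ _ _ _ _ _ mX lawX) low => w sw [N1 lw].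
exists (\max_(k <- [:: N0; (N1 + K)%N; K.+1; K1; K2; K3; K4; K5]) k)%N => n Nn.
set p := p_poly _ _ _.
have {Nn} [n0 n1 n2 [m1 m2 m3 m4 m5]] :
  [/\ (N0 <= n)%N, (N1 + K <= n)%N, (K < n)%N &
    [/\ (K1 <= n)%N, (K2 <= n)%N, (K3 <= n)%N, (K4 <= n)%N & (K5 <= n)%N]].
  by move: Nn; rewrite !big_cons big_nil !geq_max => /and5P[-> -> -> -> /and5P[-> -> -> -> _]].
have nK := sK n.
have kn : (size (xi n) <= n)%N := leq_trans nK (ltnW n2).
have nN1 : (N1 <= n - size (xi n))%N.
  by rewrite leq_subRL // addnC (leq_trans _ n1) // leq_add2l.
have [xi_n0 _ xi0far xinear] := hxi n n0.
set x0 := (xi n)`_0 in xi0far *.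
set s := [seq cplx (X j w) | j <- iota 0 (n - size (xi n))] ++ behead (xi n).
have pE : p = ('X - x0%:P) * prod_roots s by exact: p_polyE.
have np : 0 < n%:R :> R by rewrite ltr0n (leq_ltn_trans _ n2).
have ssize : (size s)%:R <= n%:R :> R.
  rewrite ler_nat size_cat size_map size_iota size_behead.
  by rewrite (leq_trans (leq_add (leqnn _) (leq_pred _))) // subnK.
have bhead x : x \in behead (xi n) -> N_mu mu eps x.
  move=> /(nthP 0)[l]; rewrite size_behead nth_behead => lsz <-.
  by apply: xinear; rewrite ltn0Sn /= -ltn_predRL.
have near x : x \in s -> N_mu mu eps x.
  rewrite mem_cat => /orP[/mapP[j _ ->]|]; last exact: bhead.
  by exists (cplx (X j w)); [left; exact: sw|rewrite subrr normr0 ltcR].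
have far z x : ~ N_mu mu (2 * eps) z -> x \in s -> b * (1 + normc z) <= normc (z - x).
  move=> nz /near xn.
  (* Some y in the support or M_mu is within eps of x, while z is at least 2 eps away from y. *)
  have zx : eps <= normc (z - x).
    have [y hy xy] := N_muP _ _ _ _ xn.
    by have := N_mu_far _ _ _ _ _ nz hy; have := normc_dist z x y; lra.
  have xB := NB _ _ xn.
  rewrite /b mulrC ler_pdivrMr; last by rewrite addr_gt0 // divr_gt0 //; lra.
  have := normcD (z - x) x; rewrite subrK => zxx.
  have h : 1 + B + eps <= normc (z - x) * ((1 + B + eps) / eps).
    rewrite mulrCA -[X in X <= _]mulr1 ler_wpM2l //; first by lra.
    by rewrite ler_pdivlMr // mul1r.
  rewrite mulrDr mulr1; lra.
have lower z : ~ N_mu mu (2 * eps) z ->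
    c * n%:R <= normc (log_deriv s z) * (1 + normc z).
  move=> nz.
  have D0 : 0 < 1 + normc z by have := normc_ge0 z; lra.
  have l1 := lw (n - size (xi n))%N nN1 z nz.
  rewrite sample_sumE in l1.
  (* The weighted loss is at most K/b from the deterministic roots and c0 K from having only n - k_n
     samples; together these fit into c0 n / 2. *)
  have l2 : normc (log_deriv (behead (xi n)) z) * (1 + normc z) <= K%:R / b.
    rewrite -ler_pdivlMr //.
    apply: le_trans (normc_sum _ _ _) _.
    apply: (@le_trans _ _ (\sum_(x <- behead (xi n)) (b * (1 + normc z))^-1)).
      rewrite big_seq [leRHS]big_seq; apply: ler_sum => x xs.
      have xin : x \in s by rewrite mem_cat xs orbT.
      have h := far _ _ nz xin.
      rewrite normcV lef_pV2 ?posrE ?mulr_gt0 //.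
      by apply: lt_le_trans h; rewrite mulr_gt0.
    rewrite big_const_seq count_predT iter_addr_0 -[leLHS]mulr_natl.
    rewrite invfM mulrA.
    have iD : 0 <= (1 + normc z)^-1 by rewrite invr_ge0 ltW.
    have ib : 0 <= b^-1 by rewrite invr_ge0 ltW.
    apply: ler_wpM2r => //; apply: ler_wpM2r => //; rewrite ler_nat size_behead.
    exact: leq_trans (leq_pred _) nK.
  have sE : log_deriv s z = log_deriv [seq cplx (X j w) | j <- iota 0 (n - size (xi n))] z
     + log_deriv (behead (xi n)) z by rewrite /log_deriv /s big_cat.
  have l3 : c0 * (n%:R - K%:R) <= c0 * (n - size (xi n))%:R.
    rewrite natrB //; apply: ler_wpM2l; first exact: ltW.
    by rewrite lerB // ler_nat.
  have l4 : K%:R / b <= c0 * n%:R / 2 - c0 * K%:R.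
    have := ler_wpM2l (ltW c00) (hK1 _ m1).
    have -> : c0 * (2 * K%:R + 2 * K%:R / (b * c0)) = 2 * (c0 * K%:R) + 2 * (K%:R / b).
      by field; rewrite !gt_eqF.
    lra.
  have tri := normc_dist (log_deriv [seq cplx (X j w) | j <- iota 0 (n - size (xi n))] z)
    (- log_deriv (behead (xi n)) z) 0.
  rewrite !subr0 opprK -sE normcN in tri.
  have := ler_wpM2r (ltW D0) tri; rewrite mulrDl /c; lra.
have cn2 : 2 <= c * n%:R by have := hK2 _ m2; rewrite ler_pdivrMr // mulrC.
have bcn2 : 2 <= b ^+ 2 * c ^+ 2 * n%:R.
  by have := hK3 _ m3; rewrite ler_pdivrMr ?mulr_gt0 ?exprn_gt0 // mulrC.
have cn0 : 0 < c * n%:R by rewrite mulr_gt0.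
have inG z : normc (z - x0) <= 2 / (c * n%:R) * (1 + normc x0) ->
    ~ N_mu mu (2 * eps) z.
  (* No bound on |xi_1| is available beforehand. But a point z of the disc in N_mu(2 eps) has |z| <=
     B + 2 eps, which bounds |xi_1| by 2 (B + 2 eps) + 1; then |z - xi_1| < eps, and xi_1 would lie
     in N_mu(3 eps). *)
  move=> zr nz; apply: xi0far.
  have [y hy zy] := N_muP _ _ _ _ nz.
  have zB := NB _ _ nz.
  have cn4 : 4 <= c * n%:R by have := hK4 _ m4; rewrite ler_pdivrMr // mulrC.
  have cn5 : 4 * (B + 2 * eps) + 5 <= eps * (c * n%:R).
    rewrite (_ : eps * _ = n%:R * (c * eps)); last by ring.
    by have := hK5 _ m5; rewrite ler_pdivrMr ?mulr_gt0.
  move: zr; rewrite mulrAC ler_pdivlMr // => zr.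
  have t1 := normcD (x0 - z) z; rewrite subrK normcB in t1.
  have h1 := ler_wpM2l (normc_ge0 (z - x0)) cn4.
  have x0B : normc x0 <= 2 * (B + 2 * eps) + 1 by lra.
  have h2 : normc (z - x0) < eps.
    by rewrite -(ltr_pM2r cn0); lra.
  exists y => //; rewrite normrC_normc ltcR.
  by have := normc_dist x0 z y; rewrite (normcB x0 z); lra.
have [w1 [r1 g1 u1 mu1 d1]] :=
  @outlier_critical_point _ s x0 [set z | ~ N_mu mu (2 * eps) z] b c n%:R
    b0 cp np ssize cn2 bcn2 far lower inG.
exists w1; rewrite pE; split => //.
rewrite !normrC_normc -(rmorph1 (real_complex R)) -rmorphD -rmorphM lecR.
by move: d1; rewrite invfM mulrA.
Qed.
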